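(* Let $M$ be a Pincherle realiser. Then $\mathcal{I}$ is computable in $M$ and the Suslin functional $\mathbf{S}$.
   Context: Let $C=\{0,1\}^{\mathbb{N}}$ with the pointwise order. For $F:C\to C$ define $f_0$ = constant $0$, $f_{\beta+1}=\max\{f_\beta,F(f_\beta)\}$, $f_\beta=\sup_{\gamma<\beta}f_\gamma$ for limit $\beta$; let $\alpha_F$ be the least $\alpha$ with $f_\alpha=f_{\alpha+1}$ and $\mathcal{I}(F)=f_{\alpha_F}\in C$. $\mathbf{S}:\mathbb{N}^{\mathbb{N}}\to\{0,1\}$: $\mathbf{S}(f)=0$ if $\forall g\exists n\,f(\bar g(n))=0$ and $\mathbf{S}(f)=1$ if $\exists g\forall n\,f(\bar g(n))>0$, where $\bar g(n)$ is (the code of) $(g(0),\dots,g(n-1))$. A Pincherle realiser is a total functional $M$ such that whenever $F:C\to\mathbb{N}$, $M(F)=N\in\mathbb{N}$ satisfies: if $G:C\to\mathbb{N}$ is such that for all $f,g\in C$, $G(g)\le F(f)$ whenever $\bar g(F(f))=\bar f(F(f))$, then $G$ is bounded by $N$ on $C$. Computability is Kleene computability: $\{e\}(M,\vec F,\vec f,\vec a)=c$ (with $\vec F$ total type-2 functionals, $\vec f$ from $\mathbb{N}^{\mathbb{N}}$, $\vec a$ from $\mathbb{N}$) is the least relation given by: S1: $e=\langle1\rangle$, value $a_1+1$. S2: $e=\langle2,q\rangle$, value $q$. S3: $e=\langle3\rangle$, value $a_1$. S4: $e=\langle4,e_1,e_2\rangle$, value $\{e_1\}(M,\vec F,\vec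 f,b,\vec a)$ where $b=\{e_2\}(M,\vec F,\vec f,\vec a)$. S6: permutations of the arguments of each type. S7: $e=\langle7\rangle$, value $f_1(a_1)$. S8.2: $e=\langle8,2,d\rangle$, value $F_1(g)$ when $g(a)=\{d\}(M,\vec F,\vec f,a,\vec a)$ is total. S8.3: $e=\langle8,3,d\rangle$, value $M(\lambda h.\{d\}(M,\vec F,h,\vec f,\vec a))$ when the argument is total on $C$. S9: $e=\langle9\rangle$, $\{e\}(M,\vec F,\vec f,d,\vec a)=\{d\}(M,\vec F,\vec f,\vec a)$. That $\mathcal{I}$ is computable in $M$ and $\mathbf{S}$ means: there is an index $e$ such that $\mathcal{I}(F)(b)=\{e\}(M,\mathbf{S},F',b)$ for all $F:C\to C$ and $b\in\mathbb{N}$, where $F'$ is the type-2 functional coding $F$ via $F'(n^\frown f)=F(f)(n)$, $f\in C$, $n\in\mathbb{N}$ (with $n^\frown f$ the function with value $n$ at $0$ and $f(k)$ at $k+1$).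
   Formalization: Kleene computability is taken with the scheme S5 (primitive recursion on the first numerical argument) added to the listed S1–S4 and S6–S9; without it the listed schemes give no definition by cases or predecessor, and the claim fails for the sequence coding used. *)

(* Defs.v *)
From mathcomp Require Import all_boot.
From mathcomp Require Import boolp wochoice.

Set Implicit Arguments.
Unset Strict Implicit.
Unset Printing Implicit Defensive.

Local Open Scope nat_scope.

Definition cantor := nat -> bool.
Definition baire := nat -> nat.
Definition type2 := baire -> nat.
Definition type3 := (cantor -> nat) -> nat.

(* C is regarded as a subset of N^N through the coercion bool >-> nat. *)
Definition bits (c : cantor) : baire := fun n => c n.

Definition baire_cons (n : nat) (f : baire) : baire :=
  fun k => if k is k'.+1 then f k' else n.

(* [code] is a bijection between finite sequences of naturals and naturals;
   it serves both for the sequence numbers g(0),...,g(n-1) and for the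
   Kleene indices <...>. *)
Notation code := CodeSeq.code.
Definition initial (g : baire) (n : nat) : nat := code (mkseq g n).

(** * The functional I *)

Definition cle (f g : cantor) : Prop := forall n, f n -> g n.
Definition czero : cantor := fun=> false.
Definition cmax (f g : cantor) : cantor := fun n => f n || g n.
Definition csup (A : cantor -> Prop) : cantor :=
  fun n => `[< exists2 f, A f & f n >].

Section Positions.
Variables (T : Type) (le : rel T).

Definition slt (x y : T) : bool := le x y && ~~ le y x.
Definition is_least (x : T) : Prop := forall y, le x y.
Definition is_succ (x y : T) : Prop :=
  slt x y /\ forall z, slt x z -> le y z.
Definition is_limit (y : T) : Prop :=
  ~ is_least y /\ forall x, ~ is_succ x y.

End Positions.

(* Ordinals are represented by the positions of an arbitrary well-ordered
   type: f x is the stage f_beta, for beta the order type of {y | y < x}. *)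
Record stages (F : cantor -> cantor) (T : Type) (le : rel T)
    (f : T -> cantor) : Prop := Stages {
  stages_wo : well_order le;
  stages_zero : forall x, is_least le x -> f x = czero;
  stages_succ : forall x y, is_succ le x y -> f y = cmax (f x) (F (f x));
  stages_limit : forall y, is_limit le y ->
    f y = csup (fun c => exists2 x, slt le x y & c = f x) }.

(* f_alpha = f_(alpha+1), where f_(alpha+1) = max {f_alpha, F(f_alpha)}. *)
Definition stationary (F : cantor -> cantor) (c : cantor) : Prop :=
  c = cmax c (F c).

Definition is_closure (F : cantor -> cantor) (c : cantor) : Prop :=
  exists (T : Type) (le : rel T) (f : T -> cantor) (alpha : T),
    [/\ stages F le f,
        stationary F (f alpha),
        forall gamma, slt le gamma alpha -> ~ stationary F (f gamma)
      & c = f alpha].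

Section WellOrder.
Variables (T : Type) (le : rel T).
Hypothesis wo : well_order le.
Local Notation lt := (slt le).

Lemma wo_min (P : T -> Prop) :
  (exists x, P x) -> exists2 x, P x & forall y, P y -> le x y.
Proof.
move=> [x Px]; have [|z [[Pz lez] _]] := wo (A := fun x => `[< P x >]).
  by exists x; apply/asboolP.
exists z; first exact/asboolP.
by move=> y Py; apply: lez; apply/asboolP.
Qed.

Lemma wo_refl x : le x x.
Proof.
by have [|_ -> /(_ x erefl)] := @wo_min (fun y => y = x); first by exists x.
Qed.

Lemma wo_total x y : le x y || le y x.
Proof.
have [|z [->|->] min] := @wo_min (fun z => z = x \/ z = y).
- by exists x; left.
- by rewrite min //; right.
- by rewrite min ?orbT //; left.
Qed.

Lemma wo_anti x y : le x y -> le y x -> x = y.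
Proof.
move=> xy yx; have [|z [_ uniq]] := wo (A := fun z => `[< z = x \/ z = y >]).
  by exists x; apply/asboolP; left.
have refl := wo_refl.
transitivity z; [symmetry|]; apply: uniq; split.
- by apply/asboolP; left.
- by move=> w /asboolP[]->.
- by apply/asboolP; right.
- by move=> w /asboolP[]->.
Qed.

Lemma wo_nle x y : ~~ le x y = lt y x.
Proof. by rewrite /slt; have := wo_total x y; case: (le x y); case: (le y x). Qed.

Lemma wo_lt_neq x y : le x y -> x <> y -> lt x y.
Proof.
move=> xy ne; rewrite /slt xy /=; apply/negP => yx.
exact/ne/wo_anti.
Qed.

Lemma wo_trans x y z : le x y -> le y z -> le x z.
Proof.
move=> xy yz.
have [|w Pw min] := @wo_min (fun w => [\/ w = x, w = y | w = z]).
  by exists x; constructor 1.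
have := min x (Or31 _ _ erefl); have := min y (Or32 _ _ erefl).
have := min z (Or33 _ _ erefl).
case: Pw => -> // h1 h2 h3.
  by rewrite (wo_anti xy h3).
by rewrite -(wo_anti yz h2).
Qed.

Lemma wo_le_lt x y z : le x y -> lt y z -> lt x z.
Proof.
move=> xy; rewrite -!wo_nle; apply: contra => zx; exact: wo_trans zx xy.
Qed.

Lemma wo_lt_le x y z : lt x y -> le y z -> lt x z.
Proof.
move=> xy yz; move: xy; rewrite -!wo_nle; apply: contra => zx.
exact: wo_trans yz zx.
Qed.

Lemma wo_wf : well_founded lt.
Proof.
move=> x; apply: contrapT => nx.
have [|y ny min] := @wo_min (fun x => ~ Acc lt x); first by exists x.
apply: ny; constructor => z zy; apply: contrapT => /min.
by apply/negP; rewrite wo_nle.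
Qed.

Lemma wo_succ x y : lt x y -> exists2 z, is_succ le x z & le z y.
Proof.
move=> xy; have [|z xz min] := @wo_min (fun z => lt x z); first by exists y.
by exists z; [split | apply: min].
Qed.

Lemma pos_case y : [\/ is_least le y, exists x, is_succ le x y | is_limit le y].
Proof.
have [Hl|nl] := pselect (is_least le y); first by constructor 1.
have [Hs|ns] := pselect (exists x, is_succ le x y); first by constructor 2.
by constructor 3; split=> // x sx; apply: ns; exists x.
Qed.

End WellOrder.

Section StagesTheory.
Variables (F : cantor -> cantor) (T : Type) (le : rel T) (f : T -> cantor).
Hypothesis fP : stages F le f.
Local Notation lt := (slt le).
Let wo := stages_wo fP.

Lemma stages_step x y : lt x y -> cle (cmax (f x) (F (f x))) (f y).
Proof.
elim/(well_founded_ind (wo_wf wo)): y x => y IH x xy.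
have [ly|[z zy]|limy] := pos_case le y.
- by move: xy; rewrite -wo_nle // ly.
- rewrite (stages_succ fP zy); have [<-//|ne] := pselect (x = z).
  have xz : lt x z.
    rewrite -wo_nle //; apply/negP => zx.
    have: lt z x by apply: wo_lt_neq => // e; apply: ne.
    by move=> /(proj2 zy); apply/negP; rewrite wo_nle.
  by move=> n /(IH z (proj1 zy) x xz n); rewrite /cmax => ->.
- have [z xz zy] := wo_succ wo xy.
  rewrite (stages_limit fP limy) -(stages_succ fP xz) => n fzn.
  apply/asboolP; exists (f z) => //; exists z => //.
  by apply: wo_lt_neq => // zE; apply: (proj2 limy x); rewrite -zE.
Qed.

Lemma stages_mono x y : le x y -> cle (f x) (f y).
Proof.
move=> xy; have [<-//|ne] := pselect (x = y).
move=> n fxn; apply: (@stages_step x y (wo_lt_neq wo xy ne)).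
by rewrite /cmax fxn.
Qed.

End StagesTheory.

Lemma cle_anti f g : cle f g -> cle g f -> f = g.
Proof. by move=> fg gf; apply/funext => n; apply/idP/idP; [apply: fg|apply: gf]. Qed.

Lemma is_closure_le F c1 c2 : is_closure F c1 -> is_closure F c2 -> cle c1 c2.
Proof.
move=> [T1 [le1 [f1 [a1 [S1 st1 min1 ->]]]]] [T2 [le2 [f2 [a2 [S2 st2 min2 ->]]]]].
have wo1 := stages_wo S1; have wo2 := stages_wo S2.
suff H x : le1 x a1 -> exists2 y, le2 y a2 & f1 x = f2 y.
  have [y ya ->] := H a1 (wo_refl wo1 a1); exact: (stages_mono S2).
elim/(well_founded_ind (wo_wf wo1)): x => x IH xa.
have [lx|[z zx]|limx] := pos_case le1 x.
- have [|y _ ly] := wo_min wo2 (P := fun=> True); first by exists a2.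
  exists y; first exact: ly.
  by rewrite (stages_zero S1 lx) (stages_zero S2) // => w; apply: ly.
- have za : slt le1 z a1 by apply: wo_lt_le wo1 _ _ _ (proj1 zx) xa.
  have [y ya e] := IH z (proj1 zx) (proj1 (andP za)).
  have [ye|ne] := pselect (y = a2).
    by case: (min1 z za); rewrite e ye.
  have [w yw wa] := wo_succ wo2 (wo_lt_neq wo2 ya ne).
  by exists w => //; rewrite (stages_succ S1 zx) (stages_succ S2 yw) e.
have {}IH z : slt le1 z x -> exists2 y, le2 y a2 & f1 z = f2 y.
  move=> zx; apply: IH => //.
  by apply: wo_trans wo1 _ _ _ _ xa; case/andP: zx.
pose P y := forall z, slt le1 z x -> cle (f1 z) (f2 y).
have Pa : P a2 by move=> z /IH[y ya ->]; apply: stages_mono S2 _ _ ya.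
have [|y Py miny] := wo_min wo2 (P := P); first by exists a2.
exists y; first exact: miny.
rewrite (stages_limit S1 limx); apply: cle_anti => n.
  by move=> /asboolP[c [z zx ->]]; apply: Py.
have below w : slt le2 w y -> exists z y', [/\ slt le1 z x, slt le2 w y' & f1 z = f2 y'].
  rewrite -(wo_nle wo2) => /negP nyw; apply: contrapT => H.
  apply/nyw/miny => z zx; have [y' _ e] := IH z zx.
  rewrite e; apply: (stages_mono S2); apply: contrapT => /negP.
  by rewrite (wo_nle wo2) => wy'; apply: H; exists z, y'.
have [ly|[w wy]|limy] := pos_case le2 y.
- by rewrite (stages_zero S2 ly).
- have [z [y' [zx wy' e]]] := below w (proj1 wy).
  move=> fyn; apply/asboolP; exists (f1 z); first by exists z.
  by rewrite e; apply: (stages_mono S2) fyn; apply: (proj2 wy).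
- rewrite (stages_limit S2 limy) => /asboolP[_ [w wy ->] fwn].
  have [z [y' [zx wy' e]]] := below w wy.
  apply/asboolP; exists (f1 z); first by exists z.
  by rewrite e; apply: (stages_mono S2) fwn; case/andP: wy'.
Qed.

Lemma is_closure_unique F c1 c2 : is_closure F c1 -> is_closure F c2 -> c1 = c2.
Proof. by move=> h1 h2; apply: cle_anti; apply: is_closure_le; eassumption. Qed.

Lemma stages_exist F (T : Type) (le : rel T) :
  well_order le -> exists f, stages F le f.
Proof.
move=> wo.
pose body (y : T) (rec : forall x, slt le x y -> cantor) : cantor := fun n =>
  `[< exists x (p : slt le x y),
        (is_succ le x y /\ cmax (rec x p) (F (rec x p)) n) \/
        (is_limit le y /\ rec x p n) >].
have bodyE y (r1 r2 : forall x, slt le x y -> cantor) :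
    (forall x p, r1 x p = r2 x p) -> body y r1 = body y r2.
  move=> e; congr (body y _); apply: functional_extensionality_dep => x.
  exact/funext/e.
pose f := Fix (wo_wf wo) (fun=> cantor) body.
have fE y : f y = body y (fun x _ => f x) by exact: Fix_eq.
exists f; split=> //.
- move=> y ly; rewrite fE; apply/funext => n; apply/asboolP => -[x [p _]].
  by move: p; rewrite -wo_nle // ly.
- move=> x y xy; rewrite fE; apply/funext => n; apply/asboolP/idP.
    move=> [z [p [[zy h]|[limy _]]]]; last by case: (proj2 limy x).
    suff -> : x = z by [].
    apply: (wo_anti wo); apply: contrapT => /negP; rewrite wo_nle //.
      by move=> /(proj2 zy); apply/negP; rewrite wo_nle //; case: xy.
    by move=> /(proj2 xy); apply/negP; rewrite wo_nle.
  by move=> h; exists x, (proj1 xy); left.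
- move=> y limy; rewrite fE; apply/funext => n; apply/asboolP/asboolP.
    move=> [z [p [[zy _]|[_ h]]]]; first by case: (proj2 limy z).
    by exists (f z) => //; exists z.
  by move=> [_ [z p ->] h]; exists z, p; right.
Qed.

Lemma is_closure_exists F : exists c, is_closure F c.
Proof.
have [le wo] := well_ordering_principle {classic cantor}.
have [f fP] := stages_exist F wo.
suff ex : exists x, stationary F (f x).
  have [a sta min] := wo_min wo ex.
  exists (f a), {classic cantor}, le, f, a; split=> // g ga /min.
  by apply/negP; rewrite wo_nle.
apply: contrapT => no.
have new x : {n | F (f x) n && ~~ f x n}.
  apply: cid; apply: contrapT => h; apply: no; exists x.
  apply/funext => n; rewrite /cmax; case fxn: (f x n) => //=.
  by case Fn: (F (f x) n) => //; case: h; exists n; rewrite Fn fxn.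
pose g x := sval (new x).
have gP x : F (f x) (g x) && ~~ f x (g x) by rewrite /g; case: (new x).
have lt_neq x y : slt le x y -> g x <> g y.
  move=> /(stages_step fP)/(_ (g x)) + e; have /andP[h _] := gP x.
  rewrite /cmax h orbT => /(_ isT); rewrite e.
  by have /andP[_ /negPf->] := gP y.
have ginj x y : g x = g y -> x = y.
  move=> e; apply: contrapT => ne; have /orP[xy|yx] := wo_total wo x y.
    by apply: lt_neq e; apply: wo_lt_neq.
  by apply: (lt_neq y x) => //; apply: wo_lt_neq => // yx'; apply: ne.
pose d : cantor := fun n => `[< exists2 c : cantor, g c = n & ~~ c n >].
have dP : d (g d) = ~~ d (g d).
  apply/asboolP/idP; first by move=> [c /ginj ->].
  by move=> h; exists d.
by case: (d (g d)) dP.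
Qed.

Definition closureI (F : cantor -> cantor) : cantor :=
  sval (cid (is_closure_exists F)).

Lemma closureIP F c : is_closure F c <-> c = closureI F.
Proof.
rewrite /closureI; case: cid => d dP /=; split=> [h|-> //].
exact: is_closure_unique h dP.
Qed.

(* The values of F' outside { n^f : n in N, f in C } are unconstrained. *)
Definition represents (F' : type2) (F : cantor -> cantor) : Prop :=
  forall (n : nat) (f : cantor), F' (baire_cons n (bits f)) = F f n.

(** * The Suslin functional and Pincherle realisers *)

Definition suslin : type2 := fun f =>
  `[< exists g : baire, forall n, 0 < f (initial g n) >].

Definition pincherle_realiser (M : type3) : Prop :=
  forall F G : cantor -> nat,
    (forall f g : cantor, mkseq g (F f) = mkseq f (F f) -> G g <= F f) ->
    forall g : cantor, G g <= M F.

(** * Kleene computability *)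

(* Action of a finite permutation s of {0, ..., size s - 1}, given by its list
   of values, on an argument list xs with size s <= size xs: argument i of the
   result is argument s_i of xs, and those at positions >= size s stay put. *)
Definition finite_perm (s : seq nat) : bool := perm_eq s (iota 0 (size s)).
Definition permute (A : Type) (s : seq nat) (xs : seq A) : seq A :=
  pmap (onth xs) s ++ drop (size s) xs.

(* [kleene M e Fs fs xs c] is {e}(M, Fs, fs, xs) = c.  S5 is primitive
   recursion on the first numerical argument; without it the other schemes
   yield neither predecessor nor definition by cases. *)
Inductive kleene (M : type3) :
    nat -> seq type2 -> seq baire -> seq nat -> nat -> Prop :=
| KS1 Fs fs x xs :
    kleene M (code [:: 1]) Fs fs (x :: xs) x.+1
| KS2 q Fs fs xs :
    kleene M (code [:: 2; q]) Fs fs xs q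
| KS3 Fs fs x xs :
    kleene M (code [:: 3]) Fs fs (x :: xs) x
| KS4 e1 e2 Fs fs xs b c :
    kleene M e2 Fs fs xs b ->
    kleene M e1 Fs fs (b :: xs) c ->
    kleene M (code [:: 4; e1; e2]) Fs fs xs c
| KS5_0 e1 e2 Fs fs xs c :
    kleene M e1 Fs fs xs c ->
    kleene M (code [:: 5; e1; e2]) Fs fs (0 :: xs) c
| KS5_S e1 e2 Fs fs x xs b c :
    kleene M (code [:: 5; e1; e2]) Fs fs (x :: xs) b ->
    kleene M e2 Fs fs (x :: b :: xs) c ->
    kleene M (code [:: 5; e1; e2]) Fs fs (x.+1 :: xs) c
| KS6 d s2 s1 s0 Fs fs xs c :
    finite_perm s2 -> size s2 <= size Fs ->
    finite_perm s1 -> size s1 <= size fs ->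
    finite_perm s0 -> size s0 <= size xs ->
    kleene M d (permute s2 Fs) (permute s1 fs) (permute s0 xs) c ->
    kleene M (code [:: 6; d; code s2; code s1; code s0]) Fs fs xs c
| KS7 Fs f fs x xs :
    kleene M (code [:: 7]) Fs (f :: fs) (x :: xs) (f x)
| KS8_2 d F Fs fs xs (g : baire) :
    (forall x, kleene M d (F :: Fs) fs (x :: xs) (g x)) ->
    kleene M (code [:: 8; 2; d]) (F :: Fs) fs xs (F g)
| KS8_3 d Fs fs xs (G : cantor -> nat) :
    (forall h : cantor, kleene M d Fs (bits h :: fs) xs (G h)) ->
    kleene M (code [:: 8; 3; d]) Fs fs xs (M G)
| KS9 d Fs fs xs c :
    kleene M d Fs fs xs c ->
    kleene M (code [:: 9]) Fs fs (d :: xs) c.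

(* Main.v *)
(** Code the whole iteration in one point X of C: X(<k,n>) says that k has
    entered before the stage at which n enters.  With the Suslin functional one
    can find, for every h in C different from X, a place where h differs from X
    without knowing X: on the largest well-founded and hereditarily correct part
    h agrees with X, and the first stage where h goes wrong can be computed from
    that part.  Let H_v(h) exceed such a place if h differs from X, let H_v(X) = v
    if b is in I(F), and H_v(X) = 0 otherwise.  Only X itself covers X, so
    M(H_v) >= v if b is in I(F).  Put N = M(H_0).  If b is not in I(F), then
    H_(N+1) and H_0 are the same functional and M(H_(N+1)) = N; otherwise
    M(H_(N+1)) > N.  Hence b is in I(F) iff M(H_0) < M(H_(N+1)). *)

Require Import Defs.
From mathcomp Require Import all_boot.
From mathcomp Require Import boolp wochoice.

Set Implicit Arguments.
Unset Strict Implicit.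
Unset Printing Implicit Defensive.

(** * Number quantifiers, pairing and sequence codes *)

Definition exb (P : nat -> bool) : bool := `[< exists n, P n >].
Definition allb (P : nat -> bool) : bool := ~~ exb (fun n => ~~ P n).

Lemma exbP (P : nat -> bool) : reflect (exists n, P n) (exb P).
Proof. exact: asboolP. Qed.

Lemma allbP (P : nat -> bool) : reflect (forall n, P n) (allb P).
Proof.
apply: (iffP negP) => [h n | h /exbP[n]]; last by rewrite h.
by apply: contrapT => /negP nPn; apply: h; apply/exbP; exists n.
Qed.

(* [pair k (code s)] is [code (k :: s)]. *)
Definition pair (k n : nat) : nat := 2 ^ k * n.*2.+1.
(** For [u > 0] this is the exponent of 2 in [u]: the counter stops at the first [c] for which [c]
    halvings of [u] give an odd number, and [u] rounds suffice. Bounded iteration makes it visibly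
    primitive recursive. *)
Definition hd (u : nat) : nat :=
  iter u (fun c => if odd (iter c half u) then c else c.+1) 0.
Definition tl (u : nat) : nat := iter (hd u).+1 half u.

Lemma iter_half_expn c k m : c <= k -> iter c half (2 ^ k * m) = 2 ^ (k - c) * m.
Proof.
elim: c => [|c IH] ck; first by rewrite subn0.
rewrite iterS IH ?(ltnW ck) // -(subnSK ck) expnS -mulnA mul2n.
by rewrite doubleK.
Qed.

Lemma hd_pair k n : hd (pair k n) = k.
Proof.
have step j : iter j (fun c => if odd (iter c half (pair k n)) then c else c.+1) 0
    = minn j k.
  elim: j => [|j IH]; first by rewrite min0n.
  rewrite iterS IH iter_half_expn ?geq_minr // oddM oddX /= odd_double /= orbF andbT.
  rewrite subn_eq0; case: (leqP k j) => [kj|jk]; rewrite ?leqnn.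
    by rewrite (minn_idPr (leqW kj)).
  by rewrite leqNgt jk /= (minn_idPl jk).
rewrite /hd step; apply/minn_idPr; apply: leq_trans (ltnW (ltn_expl k (ltnSn 1))) _.
by rewrite /pair leq_pmulr.
Qed.

Lemma tl_pair k n : tl (pair k n) = n.
Proof.
rewrite /tl hd_pair iterS iter_half_expn // subnn mul1n /=.
by rewrite uphalf_double.
Qed.

Lemma code_eq0 s : (code s == 0) = (s == [::]).
Proof. by case: s => //= n s; rewrite muln_eq0 expn_eq0. Qed.

Lemma hd_code x s : hd (code (x :: s)) = x.
Proof. exact: hd_pair. Qed.

Lemma iter_tl_code i s : iter i tl (code s) = code (drop i s).
Proof.
elim: i s => [|i IH] s; first by rewrite drop0.
(* The empty sequence has code 0 and [tl 0] is 0, so tails past the end stay empty. *)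
rewrite iterSr; case: s => [|x s]; first by rewrite -[tl _]/(code [::]) IH.
by rewrite (_ : tl _ = code s) ?IH //; apply: tl_pair.
Qed.

Lemma hd_iter_tl_code i s : i < size s -> hd (iter i tl (code s)) = nth 0 s i.
Proof. by move=> si; rewrite iter_tl_code (drop_nth 0 si) hd_code. Qed.

(** * Infinite paths *)

(** Only the empty sequence has code 0, so the guard restricts the test to pairs of consecutive
    entries of the coded sequence. *)
Definition path_code (step : nat -> nat -> bool) (w : nat) : bool :=
  allb (fun i => (0 < iter i.+1 tl w) ==>
    step (hd (iter i tl w)) (hd (iter i.+1 tl w))).

(** Putting [n] in front of every sequence ties the branch found by [suslin] to the start [n]. *)
Definition inf_path (step : nat -> nat -> bool) (n : nat) : bool :=
  0 < suslin (fun u => path_code step (pair n u)).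

Lemma inf_pathP (step : nat -> nat -> bool) n :
  reflect (exists2 g : baire, g 0 = n & forall i, step (g i) (g i.+1))
          (inf_path step n).
Proof.
have initE g k : pair n (initial g k) = code (mkseq (baire_cons n g) k.+1).
  by rewrite /mkseq /= (iotaDl 1 0) -map_comp.
rewrite /inf_path /suslin lt0b; apply: (iffP (asboolP _)) => [[g gP]|[g g0 gP]].
  exists (baire_cons n g) => // i.
  (* A segment of length [i + 1], with [n] in front, has entries at both [i] and [i + 1]. *)
  have := gP i.+1; rewrite lt0b initE => /allbP/(_ i).
  rewrite !hd_iter_tl_code ?size_mkseq // !nth_mkseq // iter_tl_code lt0n code_eq0.
  by rewrite -size_eq0 size_drop size_mkseq subSn // subnn.
exists (fun i => g i.+1) => k; rewrite lt0b initE; apply/allbP => i.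
rewrite iter_tl_code lt0n code_eq0 -size_eq0 size_drop size_mkseq subn_eq0 -ltnNge.
apply/implyP => ik; rewrite -iter_tl_code.
rewrite !hd_iter_tl_code ?size_mkseq ?(ltnW ik) // !nth_mkseq ?(ltnW ik) //.
by case: i {ik} => [|i]; [rewrite /= -g0|]; apply: gP.
Qed.

(** * Recognising the stages *)

Section Recognition.
Variable F : cantor -> cantor.

Definition seg (h : cantor) (n : nat) : cantor := fun k => h (pair k n).

(** Elements that never enter are assigned to the final stage, so a set closed under [F] admits
    every [n]. *)
Definition adm (Z : cantor) (n : nat) : bool :=
  F Z n || allb (fun k => F Z k ==> Z k).

(** One equation covers zero, successor and limit stages: a stage is the union of the successors of
    the stages at which its own members enter. *)
Definition correct (h : cantor) (n : nat) : bool :=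
  adm (seg h n) n &&
  allb (fun k => seg h n k ==
    exb (fun m => seg h n m && (seg h m k || F (seg h m) k))).

(* An incorrect point may be followed by any point, so the good points are the
   well-founded ones below which everything is correct. *)
Definition good (h : cantor) (n : nat) : bool :=
  ~~ inf_path (fun x y => seg h x y || ~~ correct h x) n.

(* If some point is not good, this is the first stage at which such a point
   should enter. *)
Definition common (h : cantor) : cantor := fun m =>
  [&& good h m, F (seg h m) m & allb (fun k => F (seg h m) k ==> good h k)].

(** With [c] read as a pair <k,n>: a bad [n] admissible at [common h] enters exactly at that stage,
    so a disagreement of its row with [common h] at [k] is a true error of [h]. *)
Definition differs (h : cantor) (c : nat) : bool :=
  [&& ~~ good h (tl c), adm (common h) (tl c) &
      seg h (tl c) (hd c) != common h (hd c)].

Section Good.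
Variable h : cantor.

Lemma good_correct n : good h n -> correct h n.
Proof.
move=> gn; apply: contraT => nc; case/negP: gn; apply/inf_pathP.
by exists (fun=> n) => // i; rewrite nc orbT.
Qed.

Lemma good_seg n m : good h n -> seg h n m -> good h m.
Proof.
move=> gn nm; apply: contraT; rewrite negbK => /inf_pathP[g g0 gP].
case/negP: gn; apply/inf_pathP; exists (baire_cons n g) => // -[|i] /=; last exact: gP.
by rewrite g0 nm.
Qed.

Lemma goodI n : correct h n -> (forall m, seg h n m -> good h m) -> good h n.
Proof.
move=> cn segn; apply/negP => /inf_pathP[g g0 gP].
have := gP 0; rewrite g0 cn orbF => /segn/negP[]; apply/inf_pathP.
by exists (fun i => g i.+1).
Qed.

(** A counterexample has a further counterexample in its row, which is again good; dependent choice
    over the subtype [bad] then yields a forbidden infinite path. *)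
Lemma good_ind (Q : nat -> Prop) :
  (forall n, good h n -> (forall m, seg h n m -> Q m) -> Q n) ->
  forall n, good h n -> Q n.
Proof.
move=> IH n gn; apply: contrapT => nQ.
pose bad := {m | good h m & ~ Q m}.
have next (x : bad) : {y : bad | seg h (s2val x) (s2val y)}.
  case: x => m gm nQm /=; apply: cid; apply: contrapT => no.
  apply/nQm/IH => // k mk; apply: contrapT => nQk; apply: no.
  by exists (exist2 _ _ k (good_seg gm mk) nQk).
pose g i := iter i (fun x => sval (next x)) (exist2 _ _ n gn nQ).
case/negP: (gn); apply/inf_pathP; exists (fun i => s2val (g i)) => // i.
by rewrite /= (svalP (next (g i))).
Qed.

Lemma good_irr n : good h n -> ~~ seg h n n.
Proof.
move=> gn; apply/negP => nn; case/negP: gn; apply/inf_pathP.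
by exists (fun=> n) => // i; rewrite nn.
Qed.

End Good.

(** * Entry stages, and the correctness of the test for errors *)

Section Closure.
Variables (T : Type) (le : rel T) (f : T -> cantor) (alpha : T).
Hypotheses (fP : stages F le f) (statP : stationary F (f alpha)).
Hypothesis minP : forall gamma, slt le gamma alpha -> ~ stationary F (f gamma).
Let wo := stages_wo fP.
Local Notation lt := (slt le).

(** The stage after [x] is written out by [cmax] because [x] may be the last position of [T]. The
    least such [x] is the last stage still without [n]. *)
Let enters n x := x = alpha \/ cmax (f x) (F (f x)) n.

Lemma entry_exists n : exists2 x, enters n x & forall y, enters n y -> le x y.
Proof. by apply: wo_min => //; exists alpha; left. Qed.

(* Elements outside the closure enter at [alpha]. *)
Definition entry (n : nat) : T := s2val (cid2 (entry_exists n)).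

Lemma entryP n : enters n (entry n).
Proof. exact: (s2valP (cid2 (entry_exists n))). Qed.

Lemma entry_min n y : enters n y -> le (entry n) y.
Proof. exact: (s2valP' (cid2 (entry_exists n))). Qed.

Lemma entry_le n : le (entry n) alpha.
Proof. by apply: entry_min; left. Qed.

(** With [stages_step], this merges the zero, successor and limit clauses into one law: $f_y$ is the
    union of $\max(f_x,F(f_x))$ over $x<y$. *)
Lemma stage_sup y k : f y k -> exists2 x, lt x y & cmax (f x) (F (f x)) k.
Proof.
have [ly|[x xy]|ly] := pos_case le y.
- by rewrite (stages_zero fP ly).
- by rewrite (stages_succ fP xy) => ?; exists x => //; case: xy.
- rewrite (stages_limit fP ly) => /asboolP[_ [x xy ->] fxk].
  by exists x; rewrite // /cmax fxk.
Qed.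

Lemma lt_irr x : ~ lt x x.
Proof. by rewrite /slt => /andP[->]. Qed.

(** Membership becomes a comparison of positions. Beyond [alpha] this would fail, since the default
    entry would count outsiders as members. *)
Lemma stage_entry y k : le y alpha -> f y k = lt (entry k) y.
Proof.
move=> ya; apply/idP/idP.
  move=> /stage_sup[x xy kx]; apply: (wo_le_lt wo) xy.
  by apply: entry_min; right.
move=> ky; have [kE|kF] := entryP k; last exact: stages_step fP _ _ ky _ kF.
by case: (@lt_irr alpha); apply: (wo_lt_le wo) ya; rewrite -{1}kE.
Qed.

Lemma closed_alpha x : le x alpha -> (forall k, F (f x) k -> f x k) -> x = alpha.
Proof.
move=> xa cl; apply: contrapT => ne; apply: (minP (wo_lt_neq wo xa ne)).
by apply/funext => k; rewrite /cmax; apply/esym/orb_idr/cl.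
Qed.

Lemma alpha_closed k : F (f alpha) k -> f alpha k.
Proof. by move=> Fk; rewrite statP /cmax Fk orbT. Qed.

Lemma adm_entry n : adm (f (entry n)) n.
Proof.
apply/orP; case: (entryP n) => [->|]; first by right; apply/allbP => k; apply/implyP/alpha_closed.
rewrite /cmax stage_entry ?entry_le // => /orP[/lt_irr//|]; by left.
Qed.

Lemma entry_F k x : F (f x) k -> le (entry k) x.
Proof. by move=> Fk; apply: entry_min; right; rewrite /cmax Fk orbT. Qed.

Lemma entry_adm n x : le x alpha -> adm (f x) n -> le (entry n) x.
Proof.
move=> xa /orP[/entry_F //|/allbP cl].
by rewrite (@closed_alpha x) ?entry_le // => k; apply/implyP.
Qed.

Lemma F_entry k : lt (entry k) alpha -> F (f (entry k)) k.
Proof.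
move=> ka; case: (entryP k) => [kE|]; first by rewrite kE in ka; case: (lt_irr ka).
by rewrite /cmax stage_entry ?entry_le // => /orP[/lt_irr|].
Qed.

(** True stages satisfy the equation tested by [correct]: a member [k] is its own witness, as [F]
    adds it at its entry. *)
Lemma entry_rec n k :
  f (entry n) k = exb (fun m => f (entry n) m && cmax (f (entry m)) (F (f (entry m))) k).
Proof.
have na := entry_le n.
rewrite !stage_entry //; apply/idP/exbP => [kn|[m]].
  exists k; rewrite stage_entry // kn /cmax F_entry ?orbT //.
  exact: wo_lt_le wo _ _ _ kn na.
rewrite stage_entry // => /andP[mn km]; apply: (wo_le_lt wo) mn.
by apply: entry_min; right.
Qed.

Variable h : cantor.

(** By induction on good points. Members of the row of [n] enter before [n], which gives one
    inclusion. For the other, an earliest missing [k] would make the row equal to the stage at which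
    [k] enters, and admissibility would let [n] enter there, too early. *)
Lemma good_stage n : good h n -> seg h n = f (entry n).
Proof.
move: n; apply: good_ind => n gn IH.
have /andP[admn /allbP cn] := good_correct gn; have na := entry_le n.
have {}cn k : seg h n k = exb (fun m => seg h n m && cmax (f (entry m)) (F (f (entry m))) k).
  rewrite (eqP (cn k)); congr exb; apply/funext => m.
  by case nm: (seg h n m); rewrite //= IH.
have mn m : seg h n m -> lt (entry m) (entry n).
  move=> nm; rewrite -(wo_nle wo); apply/negP => lenm.
  have nin : ~ cmax (f (entry m)) (F (f (entry m))) n.
    move=> c; have := good_irr gn; rewrite cn => /negP; apply; apply/exbP.
    by exists m; rewrite nm.
  (* If [n] has the default entry, so has [m]; but the equation for the row puts [m] into the final
     stage. *)
  have [nE|nF] := entryP n.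
    have mE : entry m = alpha by apply: (wo_anti wo); rewrite ?entry_le // -nE.
    move: nm; rewrite cn => /exbP[m' /andP[_]]; rewrite /cmax => c.
    have : f alpha m.
      have /orP[fm|Fm] := c.
        exact: (stages_mono fP) (entry_le m') _ fm.
      have [e|ne] := pselect (entry m' = alpha); first by apply: alpha_closed; rewrite -e.
      apply: (stages_step fP (wo_lt_neq wo (entry_le m') ne)).
      by rewrite /cmax Fm orbT.
    by rewrite stage_entry ?(wo_refl wo) // mE => /lt_irr.
  apply: nin; have [<-//|ne] := pselect (entry n = entry m).
  by rewrite {1}/cmax (stages_step fP (wo_lt_neq wo lenm ne) nF).
apply: cle_anti => k.
  rewrite cn => /exbP[m /andP[nm mk]]; exact: (stages_step fP (mn m nm)).
move: k; suff H x : forall k, entry k = x -> f (entry n) k -> seg h n k.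
  by move=> k; apply: H.
elim/(well_founded_ind (wo_wf wo)): x => x {}IH k kx.
rewrite (stage_entry _ na) kx => xn; apply: contraT => /negP nk.
have xa : lt x alpha by apply: wo_lt_le wo _ _ _ xn na.
have xa' : le x alpha by case/andP: xa.
(* A member of the row entering at [x] or later would force [k] into the row; members of the stage
   [f x] are in the row by induction. *)
have segE : seg h n = f x.
  apply: cle_anti => m; rewrite (stage_entry _ xa').
    move=> nm; rewrite -(wo_nle wo); apply/negP => xm; apply: nk.
    rewrite cn; apply/exbP; exists m; rewrite nm /=.
    have Fk : cmax (f x) (F (f x)) k by rewrite -kx /cmax F_entry ?orbT // kx.
    have [<-//|ne] := pselect (x = entry m).
    by rewrite /cmax (stages_step fP (wo_lt_neq wo xm ne) Fk).
  move=> mx; apply: (IH (entry m)) => //; rewrite (stage_entry _ na).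
  by apply: (wo_lt_le wo) mx _; case/andP: xn.
move: admn; rewrite segE => /(entry_adm xa') nx.
by case: (@lt_irr x); apply: (wo_lt_le wo) xn nx.
Qed.

(** Whatever enters before [n0] is good, and so is all that [F] adds with it. A good [k] cannot
    enter after [n0], since [n0] would lie in its row and be good. Nor can it enter together with
    [n0] and satisfy [common]: there [F] adds the bad [n0] as well, or the stage is closed and [k]
    already belongs to it. *)
Lemma common_stage n0 : ~~ good h n0 ->
  (forall n, ~~ good h n -> le (entry n0) (entry n)) ->
  common h = f (entry n0).
Proof.
move=> bad0 min0; have a0 := entry_le n0.
have gl k : lt (entry k) (entry n0) -> good h k.
  by rewrite -(wo_nle wo); apply: contraR => /min0.
apply/funext => k; rewrite (stage_entry _ a0); apply/idP/idP.
  case/and3P => gk; rewrite (good_stage gk) => Fk /allbP Fgood.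
  rewrite -(wo_nle wo); apply/negP => le0.
  have bad_le : ~ f (entry k) n0.
    by rewrite -(good_stage gk) => /(good_seg gk); apply/negP.
  have [e|ne] := pselect (entry n0 = entry k); last first.
    by apply: bad_le; rewrite stage_entry ?entry_le //; apply: wo_lt_neq.
  have /orP[F0|/allbP cl] := adm_entry n0.
    by move: (Fgood n0); rewrite -e F0 (negbTE bad0).
  have := implyP (cl k); rewrite e => /(_ Fk).
  by rewrite stage_entry ?entry_le // => /lt_irr.
move=> k0; have gk := gl k k0; rewrite /common gk (good_stage gk).
rewrite F_entry /=; last exact: wo_lt_le wo _ _ _ k0 a0.
apply/allbP => j; apply/implyP => /entry_F jk; apply: gl.
exact: wo_le_lt wo _ _ _ jk k0.
Qed.

Lemma min_bad n : ~~ good h n ->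
  exists2 n0, ~~ good h n0 & forall n, ~~ good h n -> le (entry n0) (entry n).
Proof.
move=> bn; have [|x [n0 [b0 <-]] min0] :=
    wo_min wo (P := fun x => exists n, ~~ good h n /\ entry n = x).
  by exists (entry n), n.
by exists n0 => // m bm; apply: min0; exists m.
Qed.

(** Admissibility at [common h] bounds the entry of [tl c] from above, and badness bounds it from
    below, by the least entry of a bad point. *)
Lemma differs_sound c : differs h c -> seg h (tl c) (hd c) <> f (entry (tl c)) (hd c).
Proof.
case/and3P => bad admc /eqP + e; apply; rewrite e.
have [n0 b0 min0] := min_bad bad.
rewrite (common_stage b0 min0) in admc *.
congr (f _ _); apply: (wo_anti wo); last exact: min0.
exact: entry_adm (entry_le n0) admc.
Qed.

(** An earliest bad [n0] without a detected error has the true stage as its row. Then [n0] is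
    correct and all members of its row are good, so [n0] is good. *)
Lemma differs_complete : ~~ exb (differs h) -> forall n, good h n.
Proof.
move=> nd n; apply: contraT => /min_bad[n0 b0 min0].
have cE := common_stage b0 min0; have a0 := entry_le n0.
case/negP: (b0); suff segE : seg h n0 = f (entry n0).
  have below m : seg h n0 m -> good h m.
    rewrite segE (stage_entry _ a0) -(wo_nle wo); apply: contraR; exact: min0.
  apply: goodI => //; rewrite /correct segE adm_entry; apply/allbP => k.
  rewrite entry_rec; apply/eqP; congr exb; apply/funext => m.
  case n0m: (f (entry n0) m); rewrite //= good_stage //.
  by apply: below; rewrite segE.
apply/funext => k; apply/eqP; apply: contraNT nd => ne; apply/exbP.
by exists (pair k n0); rewrite /differs tl_pair hd_pair b0 cE adm_entry.
Qed.

Lemma undiff_seg : ~~ exb (differs h) -> forall n, seg h n = f (entry n).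
Proof. by move=> /differs_complete gh n; apply: good_stage. Qed.

(** A [b] in the closure is added by [F] at its entry. For any other [b] the row is the final stage,
    and [F] adds nothing new to it. *)
Lemma undiff_closure : ~~ exb (differs h) -> forall b, F (seg h b) b = f alpha b.
Proof.
move=> nd b; rewrite undiff_seg // stage_entry ?(wo_refl wo) //.
apply/idP/idP => [Fb|/F_entry //].
apply: wo_lt_neq => [//|| e]; first exact: entry_le.
by move: Fb; rewrite e => /alpha_closed; rewrite stage_entry ?(wo_refl wo) // e => /lt_irr.
Qed.

End Closure.
End Recognition.

(** * Computable functionals *)

(* Keeps simplification from computing the indices. *)
#[local] Opaque CodeSeq.code.

Lemma pmap_onth_iota (A : Type) (pre xs : seq A) :
  pmap (onth (pre ++ xs)) (iota (size pre) (size xs)) = xs.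
Proof.
elim: xs pre => //= x xs IH pre.
rewrite onth_cat ltnn subnn /=; congr (_ :: _).
by rewrite -cat_rcons -(size_rcons pre x) IH.
Qed.

Lemma permute_cat (A : Type) (s : seq nat) (xs ys : seq A) :
  finite_perm s -> size s <= size xs -> permute s (xs ++ ys) = permute s xs ++ ys.
Proof.
move=> ps sx; rewrite /permute -catA; congr (_ ++ _).
  apply: eq_in_pmap => i; rewrite (perm_mem ps) mem_iota add0n /= => si.
  by rewrite onth_cat (leq_trans si sx).
rewrite drop_cat; case: (ltnP (size s) (size xs)) => // xss.
by rewrite (@drop_oversize _ _ xs) // (eqP (_ : size s - size xs == 0)) ?drop0 // subn_eq0.
Qed.

Lemma kleene_cat M e Fs fs xs ys c :
  kleene M e Fs fs xs c -> kleene M e Fs fs (xs ++ ys) c.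
Proof.
elim=> {e Fs fs xs c}.
- by move=> *; apply: KS1.
- by move=> *; apply: KS2.
- by move=> *; apply: KS3.
- by move=> e1 e2 Fs fs xs b c _ IH2 _ IH1; apply: KS4 IH2 IH1.
- by move=> *; apply: KS5_0.
- by move=> e1 e2 Fs fs x xs b c _ IH1 _ IH2; apply: KS5_S IH1 IH2.
- move=> d s2 s1 s0 Fs fs xs c p2 l2 p1 l1 p0 l0 _ IH.
  apply: KS6 => //; first by rewrite size_cat (leq_trans l0) // leq_addr.
  by rewrite permute_cat.
- by move=> *; apply: KS7.
- by move=> d F Fs fs xs g _ IH; apply: KS8_2.
- by move=> d Fs fs xs G _ IH; apply: KS8_3.
- by move=> *; apply: KS9.
Qed.

(* A context is a family of argument lists [suslin, F; fs; xs] with a fixed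
   number of numerical arguments. *)
Record context := Context {
  carrier :> Type;
  ctx_fun : carrier -> type2;
  ctx_fs : carrier -> seq baire;
  ctx_xs : carrier -> seq nat;
  arity : nat;
  size_ctx_xs : forall a, size (ctx_xs a) = arity }.

Definition push (G : context) : context.
Proof.
refine (@Context (G * nat) (fun p => ctx_fun p.1) (fun p => ctx_fs p.1)
  (fun p => p.2 :: ctx_xs p.1) (arity G).+1 _).
by move=> p /=; rewrite size_ctx_xs.
Defined.

Section Computable.
Variable M : type3.

(** The index precedes [a]: computability is uniform over the context. *)
Definition computable (G : context) (phi : G -> nat) : Prop :=
  exists e, forall a : G,
    kleene M e [:: suslin; ctx_fun a] (ctx_fs a) (ctx_xs a) (phi a).

Lemma kleene_permute e s Fs fs xs c :
  finite_perm s -> size s <= size xs ->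
  kleene M e Fs fs (permute s xs) c ->
  kleene M (code [:: 6; e; code [::]; code [::]; code s]) Fs fs xs c.
Proof. by move=> ps sx H; apply: KS6 => //; rewrite /permute !drop0. Qed.

Section Closure.
Variable G : context.
Implicit Types phi : G -> nat.

Lemma computable_const q : computable (fun _ : G => q).
Proof. by exists (code [:: 2; q]) => a; apply: KS2. Qed.

Lemma computable_var : computable (fun p : push G => p.2).
Proof. by exists (code [:: 3]) => a; apply: KS3. Qed.

Lemma computable_lift phi : computable phi -> computable (fun p : push G => phi p.1).
Proof.
(* The permutation moves the newest argument behind all others. *)
move=> [e eP]; exists (code [:: 6; e; code [::]; code [::]; code (rcons (iota 1 (arity G)) 0)]).
move=> [a n] /=; apply: kleene_permute.
- rewrite /finite_perm size_rcons size_iota perm_rcons; exact: perm_refl.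
- by rewrite size_rcons size_iota /= size_ctx_xs.
rewrite /permute size_rcons size_iota /= -(size_ctx_xs a) drop_size cats0.
rewrite -cats1 pmap_cat (pmap_onth_iota [:: n]); exact: kleene_cat.
Qed.

Lemma computable_lift1 (psi : push G -> nat) :
  computable psi -> computable (fun p : push (push G) => psi (p.1.1, p.2)).
Proof.
move=> [e eP].
exists (code [:: 6; e; code [::]; code [::]; code (0 :: rcons (iota 2 (arity G)) 1)]).
move=> [[a m] n] /=; apply: kleene_permute.
- rewrite /finite_perm /= size_rcons size_iota perm_cons perm_rcons; exact: perm_refl.
- by rewrite /= size_rcons size_iota /= size_ctx_xs.
rewrite /permute /= size_rcons size_iota /= -(size_ctx_xs a) drop_size cats0.
rewrite -cats1 pmap_cat (pmap_onth_iota [:: n; m]) -cat_cons.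
exact: kleene_cat (eP (a, n)).
Qed.

Lemma computable_let (psi : push G -> nat) phi :
  computable psi -> computable phi -> computable (fun a => psi (a, phi a)).
Proof.
move=> [e1 e1P] [e2 e2P]; exists (code [:: 4; e1; e2]) => a.
exact: KS4 (e2P a) (e1P (a, phi a)).
Qed.

Lemma computable_succ phi : computable phi -> computable (fun a => (phi a).+1).
Proof.
move=> [e eP]; exists (code [:: 4; code [:: 1]; e]) => a.
exact: KS4 (eP a) (KS1 _ _ _ _ _).
Qed.

Lemma computable_rec phi (psi : push (push G) -> nat) (alpha : G -> nat) :
  computable phi -> computable psi -> computable alpha ->
  computable (fun a => nat_rect (fun=> nat) (phi a) (fun x b => psi (a, b, x)) (alpha a)).
Proof.
move=> [e1 e1P] [e2 e2P] [e eP]; exists (code [:: 4; code [:: 5; e1; e2]; e]) => a.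
apply: KS4 (eP a) _; elim: (alpha a) => [|x IH]; first exact: KS5_0.
exact: KS5_S IH (e2P (a, _, x)).
Qed.

Lemma computable_suslin (psi : push G -> nat) :
  computable psi -> computable (fun a => suslin (fun n => psi (a, n))).
Proof.
move=> [e eP]; exists (code [:: 8; 2; e]) => a.
by apply: KS8_2 => n; apply: (eP (a, n)).
Qed.

Lemma computable_fun (psi : push G -> nat) :
  computable psi -> computable (fun a => ctx_fun a (fun n => psi (a, n))).
Proof.
(* S8.2 applies only the first functional, so the two are exchanged, and exchanged back inside the
   argument. *)
move=> [e eP]; pose swap d := code [:: 6; d; code [:: 1; 0]; code [::]; code [::]].
exists (swap (code [:: 8; 2; swap e])) => a.
apply: KS6 => //=; rewrite /permute !drop0 /=.
apply: KS8_2 => n; apply: KS6 => //=; rewrite /permute !drop0 /=.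
exact: (eP (a, n)).
Qed.

Lemma computable_app (h : G -> cantor) alpha :
  (forall a, exists fs, ctx_fs a = bits (h a) :: fs) ->
  computable alpha -> computable (fun a => h a (alpha a)).
Proof.
move=> hP [e eP]; exists (code [:: 4; code [:: 7]; e]) => a.
have := eP a; have [fs ->] := hP a => eaP.
exact: KS4 eaP (KS7 _ _ (bits (h a)) _ _ _).
Qed.

End Closure.

(** * Primitive recursive operations and case distinctions *)

Section Arithmetic.
Variable G : context.
Implicit Types (phi alpha beta : G -> nat) (b c : G -> bool).

Lemma computable_iter (psi : push G -> nat) phi alpha :
  computable psi -> computable phi -> computable alpha ->
  computable (fun a => iter (alpha a) (fun x => psi (a, x)) (phi a)).
Proof. by move=> cpsi cphi; apply: computable_rec cphi (computable_lift cpsi). Qed.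

Lemma computable_if c phi alpha :
  computable (fun a => c a) -> computable phi -> computable alpha ->
  computable (fun a => if c a then phi a else alpha a).
Proof.
move=> cc cphi calpha.
have [e eP] := computable_rec calpha (computable_lift (computable_lift cphi)) cc.
by exists e => a; have := eP a; case: (c a).
Qed.

Lemma computable_pos alpha : computable alpha -> computable (fun a => 0 < alpha a).
Proof.
move=> calpha.
have [e eP] := computable_rec (computable_const _ 0) (computable_const _ 1) calpha.
by exists e => a; have := eP a; case: (alpha a).
Qed.

Lemma computable_neg c : computable (fun a => c a) -> computable (fun a => ~~ c a).
Proof.
move=> cc; have [e eP] := computable_if cc (computable_const _ 0) (computable_const _ 1).
by exists e => a; have := eP a; case: (c a).
Qed.

Lemma computable_and b c : computable (fun a => b a) -> computable (fun a => c a) ->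
  computable (fun a => b a && c a).
Proof.
move=> cb cc; have [e eP] := computable_if cb cc (computable_const _ 0).
by exists e => a; have := eP a; case: (b a).
Qed.

Lemma computable_or b c : computable (fun a => b a) -> computable (fun a => c a) ->
  computable (fun a => b a || c a).
Proof.
move=> cb cc; have [e eP] := computable_if cb (computable_const _ 1) cc.
by exists e => a; have := eP a; case: (b a).
Qed.

Lemma computable_imply b c : computable (fun a => b a) -> computable (fun a => c a) ->
  computable (fun a => b a ==> c a).
Proof.
move=> cb cc; have [e eP] := computable_or (computable_neg cb) cc.
by exists e => a; rewrite implybE; apply: eP.
Qed.

Lemma computable_eqb b c : computable (fun a => b a) -> computable (fun a => c a) ->
  computable (fun a => b a == c a).
Proof.
move=> cb cc; have [e eP] := computable_if cb cc (computable_neg cc).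
by exists e => a; have := eP a; case: (b a); case: (c a).
Qed.

End Arithmetic.

Lemma computable_odd (G : context) (alpha : G -> nat) :
  computable alpha -> computable (fun a => odd (alpha a)).
Proof.
move=> calpha.
have [e eP] := computable_iter (computable_neg (computable_pos (@computable_var G)))
  (computable_const _ 0) calpha.
exists e => a; have := eP a; congr kleene.
by elim: (alpha a) => //= n ->; case: (odd n).
Qed.

Lemma computable_half (G : context) (alpha : G -> nat) :
  computable alpha -> computable (fun a => (alpha a)./2).
Proof.
move=> calpha; have cb := computable_lift (@computable_var G).
have [e eP] := computable_rec (computable_const G 0)
  (computable_if (computable_odd (@computable_var (push G))) (computable_succ cb) cb) calpha.
exists e => a; have := eP a; congr kleene.
by elim: (alpha a) => //= n ->; rewrite uphalf_half; case: (odd n).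
Qed.

Lemma computable_double (G : context) (alpha : G -> nat) :
  computable alpha -> computable (fun a => (alpha a).*2).
Proof.
move=> calpha.
have [e eP] := computable_iter (computable_succ (computable_succ (@computable_var G)))
  (computable_const _ 0) calpha.
by exists e => a; have := eP a; congr kleene.
Qed.

Lemma computable_pred (G : context) (alpha : G -> nat) :
  computable alpha -> computable (fun a => (alpha a).-1).
Proof.
move=> calpha.
have [e eP] := computable_rec (computable_const G 0) (@computable_var (push G)) calpha.
by exists e => a; have := eP a; case: (alpha a).
Qed.

Lemma computable_ltn (G : context) (alpha beta : G -> nat) :
  computable alpha -> computable beta -> computable (fun a => alpha a < beta a).
Proof.
move=> calpha cbeta.
have [e eP] := computable_pos
  (computable_iter (computable_pred (@computable_var G)) cbeta calpha).
have subE m n : n - m = iter m predn n.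
  by elim: m => [|m IH]; rewrite ?subn0 //= -IH subnS.
by exists e => a; rewrite -subn_gt0 subE; apply: eP.
Qed.

Lemma computable_pair (G : context) (alpha beta : G -> nat) :
  computable alpha -> computable beta -> computable (fun a => pair (alpha a) (beta a)).
Proof.
move=> calpha cbeta.
have [e eP] := computable_iter (computable_double (@computable_var G))
  (computable_succ (computable_double cbeta)) calpha.
exists e => a; have := eP a; congr kleene; rewrite /pair /=.
by elim: (alpha a) => [|n IH]; rewrite ?mul1n //= IH expnS -mulnA mul2n.
Qed.

Lemma computable_hd (G : context) (alpha : G -> nat) :
  computable alpha -> computable (fun a => hd (alpha a)).
Proof.
move=> calpha; have cv := @computable_var G.
apply: (computable_iter (psi := fun p : push G =>
  if odd (iter p.2 half (alpha p.1)) then p.2 else p.2.+1)) => //.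
- apply: computable_if => //; last exact: computable_succ.
  apply: computable_odd; apply: (computable_iter (psi := fun p => p.2./2)) => //.
    exact/computable_half/computable_var.
  exact: computable_lift.
- exact: computable_const.
Qed.

Lemma computable_tl (G : context) (alpha : G -> nat) :
  computable alpha -> computable (fun a => tl (alpha a)).
Proof.
move=> calpha; apply: (computable_iter (psi := fun p => p.2./2)) => //.
  exact/computable_half/computable_var.
exact/computable_succ/computable_hd.
Qed.

(* Along a path [g] with [g 0 = n], the head of every nonempty initial segment is [n]. *)
Lemma exb_suslin P :
  exb P = (0 < suslin (fun u => if 0 < u then nat_of_bool (P (hd u)) else 1)).
Proof.
rewrite /suslin lt0b; apply/exbP/asboolP => [[n Pn]|[g /(_ 1)]].
  exists (fun=> n) => -[|k] //.
  by rewrite /initial /= hd_code Pn; case: ifP.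
have -> : 0 < initial g 1 by rewrite lt0n code_eq0.
by rewrite lt0b hd_code => Pg; exists (g 0).
Qed.

Lemma computable_exb (G : context) (P : push G -> bool) :
  computable (fun p => P p) -> computable (fun a => exb (fun n => P (a, n))).
Proof.
move=> cP; have cv := @computable_var G.
have c1 : computable (fun p : push G =>
    if 0 < p.2 then nat_of_bool (P (p.1, hd p.2)) else 1).
  apply: computable_if; [exact: computable_pos | | exact: computable_const].
  exact: computable_let (computable_lift1 cP) (computable_hd cv).
have [e eP] := computable_pos (computable_suslin c1).
by exists e => a; rewrite exb_suslin; apply: eP.
Qed.

Lemma computable_allb (G : context) (P : push G -> bool) :
  computable (fun p => P p) -> computable (fun a => allb (fun n => P (a, n))).
Proof.
move=> cP; apply: computable_neg.
exact: (computable_exb (P := fun p => ~~ P p)) (computable_neg cP).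
Qed.

(** The default 0 is also where the search of [computable_mu] stops when there is no solution. *)
Definition mu (P : nat -> bool) : nat :=
  if pselect (exists n, P n) is left ex then ex_minn ex else 0.

Lemma muP P : exb P -> P (mu P).
Proof.
by rewrite /mu => /exbP ?; case: pselect => // ex; case: ex_minnP.
Qed.

(* Self-application through S9: [t] sends the arguments (t, n, xs) to n if the
   test succeeds at n, and to {t}(t, n + 1, xs) otherwise. *)
Lemma computable_search (G : context) (P : push G -> bool) :
  computable (fun p => P p) ->
  exists e, forall (a : G) n, P (a, n) -> (forall m, m < n -> ~~ P (a, m)) ->
    kleene M e [:: suslin; ctx_fun a] (ctx_fs a) (ctx_xs a) n.
Proof.
move=> cP.
have [ec ecP] := computable_lift (computable_neg cP).
have [e1 e1P] := computable_lift (@computable_var G).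
have [es esP] := computable_succ
  (computable_lift (computable_lift (computable_lift (@computable_var G)))).
have [ed edP] := computable_lift
  (computable_lift (computable_lift (@computable_var (push G)))).
(* At the call the arguments are t, t, n + 1, 0, n, t, n, xs. The first t is the index consumed by
   S9, the second its own first argument; the four leftovers before xs go to the end. *)
pose s := [:: 0; 1; 2] ++ iota 7 (arity G) ++ [:: 3; 4; 5; 6].
have sizes : size s = (4 + arity G).+3 by rewrite !size_cat size_iota addnA addnC.
pose call := code [:: 6; code [:: 9]; code [::]; code [::]; code s].
pose e2 := code [:: 4; code [:: 4; code [:: 4; call; code [:: 3]]; ed]; es].
(* [ec] gives the negated test as 0 or 1, and S5 evaluates [e2], hence the recursive call, only in
   the case 1. *)
pose t := code [:: 4; code [:: 5; e1; e2]; ec].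
have tP a n d : P (a, n + d) -> (forall i, i < d -> ~~ P (a, n + i)) ->
    kleene M t [:: suslin; ctx_fun a] (ctx_fs a) [:: t, n & ctx_xs a] (n + d).
  elim: d n => [|d IH] n Pn Pm; apply: KS4 (ecP (a, n, t)) _ => /=.
    by rewrite addn0 in Pn *; rewrite Pn; apply: KS5_0 (e1P (a, n, t)).
  have := Pm 0 isT; rewrite addn0 => ->.
  apply: KS5_S (KS5_0 _ (e1P (a, n, t))) _.
  apply: KS4 (esP (a, n, t, n, 0)) _; apply: KS4 (edP (a, n, t, n, 0, n.+1)) _ => /=.
  apply: KS4 (KS3 _ _ _ _ _) _; apply: kleene_permute.
  - by rewrite /finite_perm sizes /s /= !perm_cons perm_catC.
  - by rewrite sizes /= size_ctx_xs.
  rewrite /permute sizes /s /= -(size_ctx_xs a) drop_size cats0 pmap_cat.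
  rewrite (pmap_onth_iota [:: t; t; n.+1; 0; n; t; n]) /=.
  apply: KS9; rewrite addnS -addSn -!cat_cons; apply: kleene_cat; apply: IH.
    by rewrite addSnnS.
  by move=> i id; rewrite addSnnS; apply: Pm.
exists (code [:: 4; code [:: 4; t; code [:: 2; t]]; code [:: 2; 0]]) => a n Pn Pm.
apply: KS4 (KS2 _ _ _ _ _) _; apply: KS4 (KS2 _ _ _ _ _) _.
exact: (tP a 0 n).
Qed.

Lemma computable_mu (G : context) (P : push G -> bool) :
  computable (fun p => P p) -> computable (fun a => mu (fun n => P (a, n))).
Proof.
move=> cP; have cex := computable_lift (computable_exb cP).
have [e eP] := computable_search (computable_or cP (computable_neg cex)).
exists e => a; apply: eP; rewrite /mu; case: pselect => /= [ex|nex].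
- by case: ex_minnP => n -> _.
- by apply/orP; right; apply/negP => /exbP.
- case: ex_minnP => n Pn min m mn; rewrite negb_or negbK.
  apply/andP; split; last exact/exbP.
  by apply/negP => /min; rewrite leqNgt mn.
- by [].
Qed.

(** * Comparing a point with the stages *)

(** Total in [F'], so that the computations can be stated for all contexts without mentioning a
    represented operator. *)
Definition op (F' : type2) (Z : cantor) : cantor :=
  fun n => 0 < F' (baire_cons n (bits Z)).

Lemma represents_op F' F : represents F' F -> op F' = F.
Proof.
move=> rF; apply/funext => Z; apply/funext => n.
by rewrite /op rF lt0b.
Qed.

(** S7 applies only the first function argument, which is also where S8.3 puts the point it
    binds. *)
Definition reads (G : context) (h : G -> cantor) : Prop :=
  forall a, exists fs, ctx_fs a = bits (h a) :: fs.

Lemma reads_lift (G : context) (h : G -> cantor) :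
  reads h -> reads (fun p : push G => h p.1).
Proof. by move=> hP p; apply: hP. Qed.

Lemma computable_op (G : context) (Z : G -> cantor) (alpha : G -> nat) :
  computable (fun p : push G => Z p.1 p.2) -> computable alpha ->
  computable (fun a => op (ctx_fun a) (Z a) (alpha a)).
Proof.
move=> cZ calpha; apply/computable_pos.
(* [baire_cons] is obtained by recursion: its value at 0 is [alpha a], and at a successor it is [Z]
   at the predecessor. *)
have [e eP] := computable_fun (computable_rec (computable_lift calpha)
  (computable_lift1 (computable_lift1 cZ)) (@computable_var G)).
exists e => a; have := eP a; congr kleene; congr (ctx_fun a _).
by apply/funext => -[].
Qed.

Lemma computable_adm (G : context) (Z : G -> cantor) (alpha : G -> nat) :
  computable (fun p : push G => Z p.1 p.2) -> computable alpha ->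
  computable (fun a => adm (op (ctx_fun a)) (Z a) (alpha a)).
Proof.
move=> cZ calpha; apply: computable_or; first exact: computable_op.
apply: (computable_allb (P := fun p : push G =>
  op (ctx_fun p.1) (Z p.1) p.2 ==> Z p.1 p.2)).
apply: computable_imply => //.
apply: (computable_op (Z := fun p : push G => Z p.1)); last exact: computable_var.
exact: computable_lift1 cZ.
Qed.

Lemma computable_seg (G : context) (h : G -> cantor) (alpha beta : G -> nat) :
  reads h -> computable alpha -> computable beta ->
  computable (fun a => seg (h a) (alpha a) (beta a)).
Proof.
by move=> hP calpha cbeta; apply: computable_app => //; apply: computable_pair.
Qed.

Lemma computable_op_seg (G : context) (h : G -> cantor) (alpha beta : G -> nat) :
  reads h -> computable alpha -> computable beta ->
  computable (fun a => op (ctx_fun a) (seg (h a) (alpha a)) (beta a)).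
Proof.
move=> hP calpha cbeta; apply: (computable_op (Z := fun a => seg (h a) (alpha a))) => //.
apply: (computable_seg (h := fun p : push G => h p.1)); first exact: reads_lift.
  exact: computable_lift.
exact: computable_var.
Qed.

Lemma computable_correct (G : context) (h : G -> cantor) (alpha : G -> nat) :
  reads h -> computable alpha ->
  computable (fun a => correct (op (ctx_fun a)) (h a) (alpha a)).
Proof.
move=> hP calpha; have hP1 := reads_lift hP; have hP2 := reads_lift hP1.
have ca1 := computable_lift calpha; have ca2 := computable_lift ca1.
have cv := @computable_var G; have cv1 := @computable_var (push G).
apply: computable_and.
  apply: (computable_adm (Z := fun a => seg (h a) (alpha a))) => //.
  exact: computable_seg hP1 _ _.
apply: (computable_allb (P := fun p : push G => seg (h p.1) (alpha p.1) p.2 ==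
  exb (fun m => seg (h p.1) (alpha p.1) m &&
    (seg (h p.1) m p.2 || op (ctx_fun p.1) (seg (h p.1) m) p.2)))).
apply: computable_eqb; first exact: computable_seg hP1 _ _.
apply: (computable_exb (P := fun q : push (push G) => seg (h q.1.1) (alpha q.1.1) q.2 &&
    (seg (h q.1.1) q.2 q.1.2 || op (ctx_fun q.1.1) (seg (h q.1.1) q.2) q.1.2))).
apply: computable_and; first exact: computable_seg hP2 _ _.
have ck := computable_lift cv.
apply: computable_or; first exact: computable_seg hP2 _ _.
exact: computable_op_seg hP2 _ _.
Qed.

Lemma computable_good (G : context) (h : G -> cantor) (alpha : G -> nat) :
  reads h -> computable alpha ->
  computable (fun a => good (op (ctx_fun a)) (h a) (alpha a)).
Proof.
move=> hP calpha; have hP1 := reads_lift hP; have hP2 := reads_lift hP1.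
have cv := @computable_var G; have cv1 := @computable_var (push G).
apply/computable_neg/computable_pos.
apply: (computable_suslin (psi := fun p : push G =>
  path_code (fun x y => seg (h p.1) x y || ~~ correct (op (ctx_fun p.1)) (h p.1) x)
    (pair (alpha p.1) p.2))).
pose w (p : push G) := pair (alpha p.1) p.2.
have cw : computable w by apply: computable_pair => //; apply: computable_lift.
have cw1 := computable_lift cw.
pose it (q : push (push G)) := iter q.2 tl (w q.1).
have ctl (G' : context) : computable (fun p : push G' => tl p.2).
  exact/computable_tl/computable_var.
have cit : computable it by apply: (computable_iter (psi := fun p => tl p.2)).
have cit1 : computable (fun q : push (push G) => tl (it q)) by apply: computable_tl.
apply: (computable_allb (P := fun q : push (push G) => (0 < tl (it q)) ==>
  (seg (h q.1.1) (hd (it q)) (hd (tl (it q))) ||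
   ~~ correct (op (ctx_fun q.1.1)) (h q.1.1) (hd (it q))))).
apply: computable_imply; first exact: computable_pos.
have chd := computable_hd cit.
apply: computable_or.
  by apply: computable_seg hP2 _ _ => //; apply: computable_hd.
exact/computable_neg/(computable_correct hP2).
Qed.

Lemma computable_common (G : context) (h : G -> cantor) (alpha : G -> nat) :
  reads h -> computable alpha ->
  computable (fun a => common (op (ctx_fun a)) (h a) (alpha a)).
Proof.
move=> hP calpha; have hP1 := reads_lift hP.
apply: computable_and; first exact: computable_good.
apply: computable_and; first exact: computable_op_seg.
apply: (computable_allb (P := fun p : push G =>
  op (ctx_fun p.1) (seg (h p.1) (alpha p.1)) p.2 ==> good (op (ctx_fun p.1)) (h p.1) p.2)).
have cv := @computable_var G.
apply: computable_imply; last exact: computable_good hP1 _.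
by apply: (computable_op_seg hP1) => //; apply: computable_lift.
Qed.

Lemma computable_differs (G : context) (h : G -> cantor) (alpha : G -> nat) :
  reads h -> computable alpha ->
  computable (fun a => differs (op (ctx_fun a)) (h a) (alpha a)).
Proof.
move=> hP calpha; have chd := computable_hd calpha; have ctl := computable_tl calpha.
apply: computable_and; first exact/computable_neg/computable_good.
apply: computable_and.
  apply: (computable_adm (Z := fun a => common (op (ctx_fun a)) (h a))) => //.
  exact: computable_common (reads_lift hP) (@computable_var G).
apply/computable_neg/computable_eqb; first exact: computable_seg.
exact: computable_common.
Qed.

(* H_v of the header. *)
Definition probe (F : cantor -> cantor) (b v : nat) (h : cantor) : nat :=
  if exb (differs F h)
  then (pair (hd (mu (differs F h))) (tl (mu (differs F h)))).+1
  else if F (seg h b) b then v else 0.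

Lemma computable_probe (G : context) (h : G -> cantor) (beta nu : G -> nat) :
  reads h -> computable beta -> computable nu ->
  computable (fun a => probe (op (ctx_fun a)) (beta a) (nu a) (h a)).
Proof.
move=> hP cb cn.
have cd := computable_differs (reads_lift hP) (@computable_var G).
have cmu := computable_mu (P := fun p : push G => differs (op (ctx_fun p.1)) (h p.1) p.2) cd.
apply: computable_if.
- exact: (computable_exb (P := fun p : push G => differs (op (ctx_fun p.1)) (h p.1) p.2)).
- apply/computable_succ/computable_pair; [exact: computable_hd|exact: computable_tl].
- apply: computable_if => //; [exact: computable_op_seg | exact: computable_const].
Qed.

Definition top : context :=
  @Context type2 id (fun=> [::]) (fun=> [::]) 0 (fun=> erefl).
Definition top_real : context :=
  @Context (type2 * cantor) (fun p => p.1) (fun p => [:: bits p.2]) (fun=> [::]) 0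
    (fun=> erefl).

Lemma computable_M_probe :
  computable (fun q : push (push top) => M (probe (op q.1.1) q.1.2 q.2)).
Proof.
have hP : reads (fun q : push (push top_real) => q.1.1.2) by move=> q; exists [::].
have [e eP] := computable_probe hP (computable_lift (@computable_var _))
  (@computable_var _).
exists (code [:: 8; 3; e]) => -[[F' b] v]; apply: KS8_3 => h.
exact: (eP (F', h, b, v)).
Qed.

Lemma computable_closure : computable (fun p : push top =>
  M (probe (op p.1) p.2 0) < M (probe (op p.1) p.2 (M (probe (op p.1) p.2 0)).+1)).
Proof.
have c0 := computable_let computable_M_probe (computable_const _ 0).
apply: computable_ltn => //.
exact: computable_let computable_M_probe (computable_succ c0).
Qed.

End Computable.

(** * Reading the closure off the values of the realiser *)

Section Pincherle.
Variables (F : cantor -> cantor) (T : Type) (le : rel T) (f : T -> cantor) (alpha : T).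
Hypotheses (fP : stages F le f) (statP : stationary F (f alpha)).
Hypothesis minP : forall gamma, slt le gamma alpha -> ~ stationary F (f gamma).

Lemma undiff_exists : exists h, ~~ exb (differs F h).
Proof.
(* The point X: the row of each [n] is the true stage at its entry. *)
pose h : cantor := fun c => f (entry alpha fP (tl c)) (hd c).
exists h; apply/negP => /exbP[c] /(differs_sound statP minP); apply.
by rewrite /seg /h tl_pair hd_pair.
Qed.

Lemma probe_closure (M : type3) b : pincherle_realiser M ->
  (M (probe F b 0) < M (probe F b (M (probe F b 0)).+1)) = f alpha b.
Proof.
move=> hM; set v := (M _).+1.
have bE h : ~~ exb (differs F h) -> F (seg h b) b = f alpha b.
  by move=> nd; apply: (undiff_closure fP).
case fb: (f alpha b); last first.
  (* Outside the closure the value [v] is never returned, so both functionals are equal. *)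
  rewrite (_ : probe F b v = probe F b 0) ?ltnn //.
  by apply/funext => h; rewrite /probe; case: ifPn => // /bE ->; rewrite fb.
have [h0 nd0] := undiff_exists.
have h0v : probe F b v h0 = v by rewrite /probe (negbTE nd0) bE // fb.
(* The bounded functional keeps the value [v] at error-free points and is 0 elsewhere; the
   realiser's bound at [h0] is then at least [v]. *)
pose g h := if exb (differs F h) then 0 else probe F b v h.
suff gP h h' : mkseq h' (probe F b v h) = mkseq h (probe F b v h) ->
    g h' <= probe F b v h.
  by have := hM _ _ gP h0; rewrite /g (negbTE nd0) h0v.
rewrite /g; case: ifPn => // nd'; rewrite {3}/probe (negbTE nd') bE // fb.
rewrite /probe; case: ifPn => [dh e|/bE ->]; last by rewrite fb.
have := differs_sound (fP := fP) statP minP (muP dh).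
rewrite -(undiff_seg fP statP minP nd') /seg.
(* The probe at [h] is [c + 1], so the agreement of [h'] with [h] includes the place [c], where [h]
   errs and the error-free [h'] does not. *)
set c := pair _ _ in e * => ne; case: ne.
by have := congr1 (fun s => nth false s c) e; rewrite !nth_mkseq.
Qed.

End Pincherle.

Theorem lemma6p9 (M : type3) (hM : pincherle_realiser M) :
  exists e : nat, forall (F : cantor -> cantor) (F' : type2),
    represents F' F ->
    forall b : nat,
      kleene M e [:: suslin; F'] [::] [:: b] (closureI F b).
Proof.
have [e eP] := computable_closure M; exists e => F F' rF b.
have := eP (F', b); rewrite /= (represents_op rF).
have [T [le [f [alpha [fP statP minP ->]]]]] := (closureIP F _).2 erefl.
by rewrite (probe_closure fP statP minP b hM).
Qed.
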